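(* With the notation below, the homomorphisms $\deg$ and $\chi$ vanish on the subgroup $\mathcal P$ of principal divisors, and the induced map $(\deg,\chi):\mathrm{Div}(C_p)/\mathcal P\to\mathbb{R}\times(\mathbb{Z}/(p-1)\mathbb{Z})$ is an isomorphism of abelian groups.
   Context: Let $p$ be a prime and $H_p=\mathbb{Z}[1/p]\subset\mathbb{Q}$; $\chi:H_p\to\mathbb{Z}/(p-1)\mathbb{Z}$, $\chi(a/p^n)=a\bmod(p-1)$. $C_p$ is the set of subgroups $H=\lambda H_p\subset\mathbb{R}$, $\lambda>0$. For $H=\lambda H_p$ define $\chi_H:H\to\mathbb{Z}/(p-1)\mathbb{Z}$ by $\chi_H(x)=\chi(\lambda^{-1}x)$ (independent of $\lambda$). $\mathcal K(C_p)$: continuous piecewise affine functions $f:(0,\infty)\to\mathbb{R}$ with slopes in $H_p$ and $f(p\lambda)=f(\lambda)$ (plus the constant $-\infty$). For real-valued $f$ and $H=\lambda H_p$, $\mathrm{Ord}_H(f)=h_+-h_-$ with $h_\pm=\lim_{\epsilon\to0\pm}(f((1+\epsilon)\lambda)-f(\lambda))/\epsilon\in H$. A divisor $D$ on $C_p$ assigns $D(H)\in H$ to each $H\in C_p$, zero for all but finitely many $H$; $\mathrm{Div}(C_p)$ is the group of divisors under pointwise addition. $\deg(D)=\sum_H D(H)\in\mathbb{R}$, $\chi(D)=\sum_H\chi_H(D(H))$. The principal divisor of real-valued $f\in\mathcal K(C_p)$ is $(f)(H)=\mathrm{Ord}_H(f)$; $\mathcal P$ is the subgroup of principal divisors. 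*)

(* Defs.v *)
From HB Require Import structures.
From mathcomp Require Import all_boot all_order all_algebra.
From mathcomp Require Import all_classical all_reals all_analysis.
Set Implicit Arguments.
Unset Strict Implicit.
Unset Printing Implicit Defensive.
Import Order.TTheory GRing.Theory Num.Theory.
Import numFieldNormedType.Exports.
Local Open Scope classical_set_scope.
Local Open Scope ring_scope.

Section Cp.
Variables (R : realType) (p : nat).

Definition Hp : set R :=
  [set x | exists (a : int) (n : nat), x = a%:~R / (p%:R ^+ n)].

Definition scaled (l : R) : set R := [set l * x | x in Hp].

Definition in_Cp (H : set R) : Prop := exists l : R, 0 < l /\ H = scaled l.

Definition Cp : set (set R) := [set H | in_Cp H].

(* chi : H_p -> Z/(p-1)Z, chi(a/p^n) = a mod (p-1); values in Z/(p-1)Z are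
   represented by their canonical representatives in [0, p-1) (as int). *)
Definition chi_Hp (x : R) : int :=
  xget 0%R [set c : int | exists (a : int) (n : nat),
              x = a%:~R / (p%:R ^+ n) /\ c = (a %% (p.-1)%:Z)%Z].

Definition chi_H (H : set R) (x : R) : int :=
  xget 0%R [set c : int | exists l : R, 0 < l /\ H = scaled l /\ c = chi_Hp (l^-1 * x)].

Definition is_divisor (D : set R -> R) : Prop :=
  (forall H, D H != 0 -> in_Cp H) /\
  (forall H, in_Cp H -> H (D H)) /\
  finite_set [set H | D H != 0].

Definition add_div (D1 D2 : set R -> R) : set R -> R := fun H => D1 H + D2 H.

Definition deg (D : set R -> R) : R := \sum_(H \in Cp) D H.

Definition chi_div (D : set R -> R) : int :=
  ((\sum_(H \in Cp) chi_H H (D H)) %% (p.-1)%:Z)%Z.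

(* The space K(C_p) (real-valued part): continuous piecewise affine
   functions on (0,oo) with slopes in H_p and f(p x) = f(x). *)
Definition pw_affine_Hp (f : R -> R) : Prop :=
  forall a b : R, 0 < a -> a < b ->
    exists s : seq R, path <%R a s /\ last a s = b /\
      forall i : nat, (i < size s)%N ->
        exists m c : R, Hp m /\
          forall t, nth a (a :: s) i <= t <= nth a s i -> f t = m * t + c.

Definition in_K (f : R -> R) : Prop :=
  (forall x : R, 0 < x -> {for x, continuous f}) /\
  pw_affine_Hp f /\
  (forall x : R, 0 < x -> f (p%:R * x) = f x).

Definition ord_at (f : R -> R) (l : R) : R :=
  lim ((fun e => (f ((1 + e) * l) - f l) / e) @ 0^'+) -
  lim ((fun e => (f ((1 + e) * l) - f l) / e) @ 0^'-).

Definition Ord (H : set R) (f : R -> R) : R :=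
  ord_at f (xget 1 [set l : R | 0 < l /\ H = scaled l]).

Definition principal (f : R -> R) : set R -> R :=
  fun H => if pselect (in_Cp H) then Ord H f else 0.

End Cp.

(* Main.v *)
(** A point of [C_p] has a unique representative [l] in [1, p), and periodicity
    reduces everything about [f] in [K(C_p)] to its affine pieces on [1, p].  A piece on
    [u, v] with slope [m] contributes [u m] at [u] and [- v m] at [v], so the degree of
    [(f)] is the telescoping sum [f 1 - f p = 0]; it contributes [chi m] and [- chi m]
    to [chi (f)].  The seam at [1 = p] is harmless because the left slope at [1] is [p]
    times the one at [p], and [chi (p m) = chi m].  Conversely a divisor of degree [0]
    whose jumps [d_z] add up to [(p - 1) y] is realized by prescribing the jumps on
    [1, p) together with the initial slope [- p y].  For surjectivity, a single point
    [l H_p] with coefficient [l d], [d] a nonzero integer of the right residue, reaches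
    every nonzero degree of the sign of [d]; two of them reach every degree. *)
Require Import Defs.
From HB Require Import structures.
From mathcomp Require Import all_boot all_order all_algebra.
From mathcomp Require Import all_classical all_reals all_analysis.
From mathcomp Require Import ring lra.
Import Order.TTheory GRing.Theory Num.Theory.
Import numFieldNormedType.Exports.
Local Open Scope ring_scope.
Set Implicit Arguments.
Unset Strict Implicit.
Unset Printing Implicit Defensive.

(** * Arithmetic of [Hp] and of its character [chi_Hp] *)

Section Arithmetic.
Variables (R : realType) (p : nat).
Hypothesis hp : prime p.
Local Notation P := (p%:R : R).
Local Notation N := (p.-1%:Z).

Lemma prime_gt1r : 1 < P.
Proof. by rewrite ltr1n prime_gt1. Qed.

Lemma prime_gt0r : 0 < P.
Proof. exact: lt_trans ltr01 prime_gt1r. Qed.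

Lemma prime_neq0r : P != 0.
Proof. by rewrite gt_eqF ?prime_gt0r. Qed.

Lemma expz_gt0r (k : int) : 0 < P ^ k.
Proof. exact: exprz_gt0 prime_gt0r. Qed.

Lemma expz_neq0r (k : int) : P ^ k != 0.
Proof. by rewrite gt_eqF ?expz_gt0r. Qed.

Hint Resolve prime_gt1r prime_gt0r prime_neq0r expz_gt0r expz_neq0r : core.

(** Since [p = 1 + (p - 1)], multiplication by [p] is invisible modulo [p - 1]; this is what makes
    [chi] well defined on fractions [a / p^n]. *)
Lemma mulz_exp_mod (a : int) (n : nat) : (a * p%:Z ^+ n = a %[mod N])%Z.
Proof.
apply/eqP; rewrite eqz_mod_dvd -{2}[a]mulr1 -mulrBr dvdz_mull//.
rewrite -eqz_mod_dvd -modzXm; apply/eqP.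
have -> : (p%:Z = 1 %[mod N])%Z.
  apply/eqP; rewrite eqz_mod_dvd -{1}(prednK (prime_gt0 hp)) -addn1 PoszD addrK.
  exact: dvdzz.
by rewrite modzXm expr1n.
Qed.

Lemma Hp_common (x y : R) : Hp p x -> Hp p y ->
  exists a b n, x = a%:~R / P ^+ n /\ y = b%:~R / P ^+ n.
Proof.
case=> a [n ->] [b [m ->]]; exists (a * p%:Z ^+ m), (b * p%:Z ^+ n), (n + m)%N.
rewrite !rmorphM/= !rmorphXn/= !exprD.
by split; field; rewrite ?expf_neq0.
Qed.

Lemma Hp_int (a : int) : Hp p (a%:~R : R).
Proof. by exists a, 0%N; rewrite expr0 divr1. Qed.

Lemma Hp0 : Hp p (0 : R). Proof. exact: (Hp_int 0). Qed.

Lemma HpD (x y : R) : Hp p x -> Hp p y -> Hp p (x + y).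
Proof.
move=> hx hy; have [a [b [n [-> ->]]]] := Hp_common hx hy.
by exists (a + b), n; rewrite rmorphD/= mulrDl.
Qed.

Lemma HpM (x y : R) : Hp p x -> Hp p y -> Hp p (x * y).
Proof.
case=> a [n ->] [b [m ->]]; exists (a * b), (n + m)%N.
by rewrite rmorphM/= exprD; field; rewrite ?expf_neq0.
Qed.

Lemma HpN (x : R) : Hp p x -> Hp p (- x).
Proof. by case=> a [n ->]; exists (- a), n; rewrite rmorphN/= mulNr. Qed.

Lemma Hp_expz (k : int) : Hp p (P ^ k).
Proof.
case: k => n; first by rewrite -exprnP -natrX -[_%:R]/((p ^ n)%N%:~R); exact: Hp_int.
by exists 1, n.+1; rewrite mul1r NegzE.
Qed.

Lemma Hp_sum (I : eqType) (r : seq I) (F : I -> R) :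
  (forall i, i \in r -> Hp p (F i)) -> Hp p (\sum_(i <- r) F i).
Proof. by move=> h; rewrite big_seq; apply: big_ind => //; [exact: Hp0|exact: HpD]. Qed.

(** Cross-multiplying two equal fractions changes the numerators only by powers of [p], so all
    representations give the same residue and [xget] has a single candidate. *)
Lemma chi_HpE (a : int) (n : nat) : chi_Hp p (a%:~R / P ^+ n) = (a %% N)%Z.
Proof.
apply: xget_unique; first by exists a, n.
move=> _ [b [m [e ->]]].
have : a * p%:Z ^+ m = b * p%:Z ^+ n.
  apply: (@intr_inj R); rewrite !rmorphM/= !rmorphXn/=.
  have h k : P ^+ k != 0 by rewrite expf_neq0.
  have := congr1 (fun z => z * P ^+ n * P ^+ m) e.
  by rewrite divfK// => ->; rewrite mulrAC divfK.
by move=> ee; rewrite -(mulz_exp_mod b n) -ee mulz_exp_mod.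
Qed.

Lemma chi_Hp_mod (x : R) : Hp p x -> (chi_Hp p x %% N)%Z = chi_Hp p x.
Proof. by case=> a [n ->]; rewrite chi_HpE modz_mod. Qed.

Lemma chi_Hp0 : chi_Hp p (0 : R) = 0.
Proof. by have := chi_HpE 0 0; rewrite mul0r mod0z. Qed.

Lemma chi_HpD (x y : R) : Hp p x -> Hp p y ->
  (chi_Hp p (x + y) = chi_Hp p x + chi_Hp p y %[mod N])%Z.
Proof.
move=> hx hy; have [a [b [n [-> ->]]]] := Hp_common hx hy.
by rewrite -mulrDl -rmorphD/= !chi_HpE modz_mod modzDm.
Qed.

Lemma chi_Hp_expz (k : int) (x : R) : Hp p x -> chi_Hp p (P ^ k * x) = chi_Hp p x.
Proof.
case=> a [n ->]; rewrite chi_HpE; case: k => j.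
  have -> : P ^ Posz j * (a%:~R / P ^+ n) = (a * p%:Z ^+ j)%:~R / P ^+ n.
    by rewrite rmorphM/= rmorphXn/= -exprnP; ring.
  by rewrite chi_HpE mulz_exp_mod.
have -> : P ^ Negz j * (a%:~R / P ^+ n) = a%:~R / P ^+ (j.+1 + n).
  by rewrite NegzE exprD -exprnN; field; rewrite ?expf_neq0.
by rewrite chi_HpE.
Qed.

(** A numerator divisible by [p - 1] can be divided without leaving [Hp]. The quotient [y] later
    fixes the initial slope of a function with prescribed divisor. *)
Lemma chi_Hp_eq0 (x : R) : Hp p x -> chi_Hp p x = 0 ->
  exists2 y : R, Hp p y & x = (P - 1) * y.
Proof.
case=> a [n ->]; rewrite chi_HpE => /dvdz_mod0P/dvdzP[b ->].
exists (b%:~R / P ^+ n); first by exists b, n.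
rewrite rmorphM/= -[N%:~R]/(p.-1%:R).
have -> : p.-1%:R = P - 1 by rewrite -[in RHS](prednK (prime_gt0 hp)) -addn1 natrD addrK.
by ring.
Qed.

Lemma chi_Hp_int (a : int) : chi_Hp p (a%:~R : R) = (a %% N)%Z.
Proof. by have := chi_HpE a 0; rewrite expr0 divr1. Qed.

Lemma modz_sum (I : eqType) (r : seq I) (F G : I -> int) :
  (forall i, i \in r -> F i = G i %[mod N])%Z ->
  (\sum_(i <- r) F i = \sum_(i <- r) G i %[mod N])%Z.
Proof.
move=> h; rewrite big_seq [in RHS]big_seq.
apply: (big_ind2 (fun x y => x = y %[mod N])%Z) => // a b c d e1 e2.
by rewrite -modzDm e1 e2 modzDm.
Qed.

Lemma chi_Hp_sum (I : eqType) (r : seq I) (F : I -> R) :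
  (forall i, i \in r -> Hp p (F i)) ->
  (chi_Hp p (\sum_(i <- r) F i) = \sum_(i <- r) chi_Hp p (F i) %[mod N])%Z.
Proof.
elim: r => [_|i r ih h]; first by rewrite !big_nil chi_Hp0.
have hr j : j \in r -> Hp p (F j) by move=> jr; apply: h; rewrite inE jr orbT.
rewrite !big_cons chi_HpD//; last exact: Hp_sum; last by apply: h; rewrite mem_head.
by rewrite -modzDm ih// modzDm.
Qed.

Lemma chi_HpB (x y : R) : Hp p x -> Hp p y ->
  (chi_Hp p (x - y) = chi_Hp p x - chi_Hp p y %[mod N])%Z.
Proof.
move=> hx hy; have := chi_HpD (HpD hx (HpN hy)) hy; rewrite subrK => /eqP.
by rewrite eqz_mod_dvd => h; apply/eqP; rewrite eq_sym eqz_mod_dvd -addrA -opprD [chi_Hp p y + _]addrC.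
Qed.

(** * The points [scaled p l] and the fundamental domain [[1, p)] *)

Lemma scaledP (l x : R) : l != 0 -> scaled p l x <-> Hp p (l^-1 * x).
Proof.
move=> l0; split=> [[y hy <-]|h]; first by rewrite mulKf.
by exists (l^-1 * x) => //; rewrite mulVKf.
Qed.

Lemma scaled_expz (k : int) (l : R) : l != 0 -> scaled p (P ^ k * l) = scaled p l.
Proof.
move=> l0; apply/seteqP; split => x; rewrite !scaledP ?mulf_neq0//.
  move=> h; have -> : l^-1 * x = P ^ k * ((P ^ k * l)^-1 * x) by field; rewrite l0/=.
  by apply: HpM => //; exact: Hp_expz.
move=> h; have -> : (P ^ k * l)^-1 * x = P ^ (- k) * (l^-1 * x).
  by rewrite invfM invr_expz mulrA.
by apply: HpM => //; exact: Hp_expz.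
Qed.

(** The ratio [l' / l] is a positive unit of [Hp], and for a prime [p] such units are powers of
    [p]. *)
Lemma scaled_eq (l l' : R) : 0 < l -> 0 < l' -> scaled p l = scaled p l' ->
  exists k : int, l' = P ^ k * l.
Proof.
move=> l0 l'0 e.
have Hp1 : Hp p (1 : R) by exact: (Hp_int 1).
have : Hp p (l^-1 * l').
  by rewrite -scaledP ?gt_eqF// e scaledP ?gt_eqF// mulVf ?gt_eqF.
have : Hp p (l'^-1 * l).
  by rewrite -scaledP ?gt_eqF// -e scaledP ?gt_eqF// mulVf ?gt_eqF.
case=> b [m eb] [a [n ea]].
have Pn k : 0 < P ^+ k by rewrite exprn_gt0.
have a0 : 0 < a.
  have : 0 < a%:~R / P ^+ n by rewrite -ea mulr_gt0 ?invr_gt0.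
  by rewrite pmulr_lgt0 ?invr_gt0// ltr0z.
(* The two ratios are inverse to each other, so the product of their numerators is the product of
   their denominators; [a] then divides a power of the prime [p]. *)
have ab : a * b = p%:Z ^+ (n + m).
  apply: (@intr_inj R); rewrite rmorphM/= rmorphXn/= exprD.
  have -> : a%:~R = l^-1 * l' * P ^+ n by rewrite ea divfK ?gt_eqF.
  have -> : b%:~R = l'^-1 * l * P ^+ m by rewrite eb divfK ?gt_eqF.
  by field; rewrite !gt_eqF.
have /(dvdn_pfactor _ _ hp)[j _ ej] : (`|a| %| p ^ (n + m))%N.
  by have := congr1 absz ab; rewrite abszM abszX => <-; rewrite dvdn_mulr.
exists (j%:Z - n%:Z); have -> : l' = l * (a%:~R / P ^+ n) by rewrite -ea mulVKf ?gt_eqF.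
have -> : a%:~R = P ^+ j by rewrite -(gtz0_abs a0) ej -[LHS]/((p ^ j)%:R) natrX.
by rewrite expfzDr// -exprnN mulrC.
Qed.

Lemma expz_floor_log (l : R) : 0 < l -> exists k : int, 1 <= P ^ k * l < P.
Proof.
move=> l0; set k := Num.floor (ln l / ln P); exists (- k).
have lnP : 0 < ln P by rewrite ln_gt0.
have E (j : int) : ln (P ^ j) = j%:~R * ln P by rewrite -powR_intmul ?ltW// ln_powR.
have /andP[h1 h2] := floor_itv (ln l / ln P).
rewrite -invr_expz; apply/andP; split.
  by rewrite ler_pdivlMl// mulr1 -ler_ln ?posrE// E -ler_pdivlMr.
rewrite ltr_pdivrMl// -[X in _ * X]expr1z -expfzDr// -ltr_ln ?posrE// E.
by rewrite -ltr_pdivrMr.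
Qed.

Lemma expz_fundamental (k : int) (l : R) : 1 <= l < P -> 1 <= P ^ k * l < P -> k = 0.
Proof.
move=> /andP[l1 lP] /andP[h1 h2]; have l0 : 0 < l := lt_le_trans ltr01 l1.
have : P ^ (- 1) < P ^ k.
  rewrite -(ltr_pM2r l0) (lt_le_trans _ h1)// -invr_expz expr1z.
  by rewrite mulrC ltr_pdivrMr ?mul1r.
have : P ^ k < P ^ 1.
  by rewrite expr1z (le_lt_trans _ h2)// ler_peMr// ltW.
rewrite !ltr_eXz2l//; case: k {h1 h2} => [[|n]|n]//.
Qed.

Lemma scaled_fundamental (l l' : R) : 1 <= l < P -> 1 <= l' < P ->
  scaled p l = scaled p l' -> l = l'.
Proof.
move=> h h' e; have [||k ek] := scaled_eq _ _ e.
- by case/andP: h => h _; exact: lt_le_trans h.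
- by case/andP: h' => h' _; exact: lt_le_trans h'.
by rewrite ek in h' *; rewrite (expz_fundamental h h') expr0z mul1r.
Qed.

Lemma scaled_in_Cp (l : R) : 0 < l -> in_Cp p (scaled p l).
Proof. by move=> l0; exists l. Qed.

Lemma in_CpP (H : set R) : in_Cp p H -> exists2 l : R, 1 <= l < P & H = scaled p l.
Proof.
case=> l [l0 ->]; have [k hk] := expz_floor_log l0.
by exists (P ^ k * l) => //; rewrite scaled_expz// gt_eqF.
Qed.

(** Two generators of the same group differ by a power of [p], which [chi_Hp] ignores; hence every
    generator yields the same value. *)
Lemma chi_HE (l x : R) : 0 < l -> Hp p (l^-1 * x) ->
  chi_H p (scaled p l) x = chi_Hp p (l^-1 * x).
Proof.
move=> l0 h; apply: xget_unique; first by exists l.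
move=> _ [l' [l'0 [e ->]]]; have [k ->] := scaled_eq l0 l'0 e.
by rewrite invfM -mulrA invr_expz chi_Hp_expz.
Qed.

End Arithmetic.

(** * One-sided affine germs *)

Section Germs.
Variable R : realType.
Implicit Types (f : R -> R) (b : bool).

(** [b = false] is the right side and [b = true] the left side. Exact affinity on a one-sided
    neighbourhood replaces a limit, so slopes are handled by algebra alone. *)
Definition germ_slope f (x : R) b (m : R) : Prop :=
  exists2 e : R, 0 < e &
    forall h, 0 <= h <= e -> f (x + (-1) ^+ b * h) = f x + m * ((-1) ^+ b * h).

Lemma germ_slope_unique f x b m m' :
  germ_slope f x b m -> germ_slope f x b m' -> m = m'.
Proof.
case=> e e0 H [e' e'0 H'].
have h0 : 0 < Num.min e e' by rewrite lt_min e0 e'0.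
have := H (Num.min e e'); rewrite H' ?(ltW h0) ?ge_min ?lexx ?orbT//.
move=> /(_ isT)/addrI/mulIf -> //.
by rewrite mulf_neq0 ?signr_eq0// gt_eqF.
Qed.

Lemma germ_slope_cst f x b (c : R) : (forall t, f t = c) -> germ_slope f x b 0.
Proof. by move=> H; exists 1 => // h _; rewrite !H mul0r addr0. Qed.

Lemma germ_slopeD f g x b m m' : germ_slope f x b m -> germ_slope g x b m' ->
  germ_slope (fun t => f t + g t) x b (m + m').
Proof.
case=> e e0 H [e' e'0 H']; exists (Num.min e e'); first by rewrite lt_min e0.
by move=> h /andP[h0]; rewrite le_min => /andP[he he']; rewrite H ?H' ?h0//; ring.
Qed.

Lemma germ_slopeM f x b (c m : R) : germ_slope f x b m ->
  germ_slope (fun t => c * f t) x b (c * m).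
Proof. by case=> e e0 H; exists e => // h /H ->; ring. Qed.

Lemma germ_slope_sum (I : Type) (r : seq I) (F : I -> R -> R) (M : I -> R) x b :
  (forall i, germ_slope (F i) x b (M i)) ->
  germ_slope (fun t => \sum_(i <- r) F i t) x b (\sum_(i <- r) M i).
Proof.
move=> H; elim: r => [|i r ih].
  by rewrite big_nil; apply: (@germ_slope_cst _ _ _ 0) => t; rewrite big_nil.
rewrite big_cons; under eq_fun do rewrite big_cons.
exact: germ_slopeD.
Qed.

Lemma germ_slope_id x b : germ_slope id x b 1.
Proof. by exists 1 => // h _; rewrite mul1r. Qed.

(** At the corner [x = z] the right slope is 1 and the left slope 0, hence a non-strict comparison
    on the right and a strict one on the left. *)
Lemma germ_slope_ramp (z x : R) b :
  germ_slope (fun t => Num.max 0 (t - z)) x b (if b then z < x else z <= x)%:R.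
Proof.
have [xz|zx|->] := ltgtP x z.
- exists (z - x); first by rewrite subr_gt0.
  move=> h /andP[h0 he]; rewrite if_same mul0r addr0.
  by rewrite !max_l//; case: b; rewrite ?expr0 ?expr1; lra.
- exists (x - z); first by rewrite subr_gt0.
  move=> h /andP[h0 he]; rewrite if_same mul1r.
  by rewrite !max_r//; case: b; rewrite ?expr0 ?expr1; lra.
exists 1 => // h /andP[h0 _]; rewrite subrr maxxx; case: b; rewrite ?expr0 ?expr1.
  by rewrite max_l ?mul0r; lra.
by rewrite max_r ?mul1r; lra.
Qed.

(** The product of a point and the slope there is unchanged by scaling; this makes the order of [f]
    at a subgroup independent of the chosen generator. *)
Lemma germ_slope_scale f (c x m : R) b : 0 < c -> 0 < x ->
  (forall t, 0 < t -> f (c * t) = f t) ->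
  germ_slope f x b m -> germ_slope f (c * x) b (m / c).
Proof.
(* The bound [c * (x / 2)] keeps the arguments on the left side positive, as the invariance of [f]
   is given only there. *)
move=> c0 x0 fc [e e0 H]; exists (Num.min (c * e) (c * (x / 2))).
  by rewrite lt_min !mulr_gt0// invr_gt0.
move=> h /andP[h0]; rewrite le_min -!(ler_pdivrMl _ _ c0) => /andP[he hx].
have hc0 : 0 <= c^-1 * h by rewrite mulr_ge0// invr_ge0 ltW.
have -> : c * x + (-1) ^+ b * h = c * (x + (-1) ^+ b * (c^-1 * h)).
  by field; rewrite gt_eqF.
rewrite !fc//; first by rewrite H ?hc0//; congr (_ + _); field; rewrite gt_eqF.
by case: b {H}; rewrite ?expr0 ?expr1; lra.
Qed.

Lemma germ_slope_eq f g (x m : R) b :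
  (exists2 e, 0 < e & forall h, 0 <= h <= e -> f (x + (-1) ^+ b * h) = g (x + (-1) ^+ b * h)) ->
  germ_slope g x b m -> germ_slope f x b m.
Proof.
case=> e e0 H [e' e'0 H']; exists (Num.min e e'); first by rewrite lt_min e0.
move=> h /andP[h0]; rewrite le_min => /andP[he he']; rewrite H ?H' ?h0//.
by have := H 0; rewrite mulr0 addr0 lexx ltW// => ->.
Qed.

Lemma germ_slope_continuous f (x m m' : R) :
  germ_slope f x false m -> germ_slope f x true m' -> {for x, continuous f}.
Proof.
case=> e e0 H [e' e'0 H']; apply/cvgrPdist_le => eps eps0.
(* [K] dominates both one-sided slopes; the added 1 makes it positive, so that [eps / K] makes
   sense. *)
set K := `|m| + `|m'| + 1.
have K0 : 0 < K by rewrite ltr_wpDl// addr_ge0.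
have d0 : 0 < Num.min (Num.min e e') (eps / K) by rewrite !lt_min e0 e'0 divr_gt0.
near=> t.
have : `|x - t| <= Num.min (Num.min e e') (eps / K).
  by near: t; apply: cvgr_dist_le => //; exact: cvg_id.
rewrite !le_min => /andP[/andP[te te']]; rewrite ler_pdivlMr// => tK.
have [tx|xt] := leP x t.
  have ht : `|x - t| = t - x by rewrite ler0_norm ?opprB// subr_le0.
  have -> : t = x + (-1) ^+ false * (t - x) by rewrite expr0; ring.
  rewrite H; last by rewrite subr_ge0 tx -ht.
  rewrite opprD addNKr normrN expr0 mul1r normrM [`|t - x|]distrC.
  rewrite (le_trans _ tK)// mulrC ler_wpM2l// /K.
  by have := normr_ge0 m'; lra.
have ht : `|x - t| = x - t by rewrite gtr0_norm ?subr_gt0.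
have -> : t = x + (-1) ^+ true * (x - t) by rewrite expr1; ring.
rewrite H'; last by rewrite subr_ge0 ltW//= -ht.
rewrite opprD addNKr normrN expr1 mulN1r normrM normrN.
rewrite (le_trans _ tK)// mulrC ler_wpM2l// /K.
by have := normr_ge0 m; lra.
Unshelve. all: by end_near.
Qed.

(** Near 0 the difference quotient is constant on each side, equal to [l] times the slope, because
    the argument moves by [e * l]. *)
Lemma ord_at_germ f (l m m' : R) : 0 < l ->
  germ_slope f l false m -> germ_slope f l true m' -> ord_at f l = l * (m - m').
Proof.
move=> l0 [e e0 H] [e' e'0 H']; rewrite /ord_at mulrBr; congr (_ - _).
  apply: lim_near_cst => //; near=> t.
  have t0 : 0 < t by near: t; exact: nbhs_right_gt.
  have te : t <= e / l by near: t; apply: nbhs_right_le; rewrite divr_gt0.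
  have -> : (1 + t) * l = l + (-1) ^+ false * (t * l) by rewrite expr0; ring.
  rewrite H ?(mulr_ge0 (ltW t0) (ltW l0)) -?ler_pdivlMr//.
  by rewrite expr0; field; rewrite gt_eqF.
apply: lim_near_cst => //; near=> t.
have t0 : t < 0 by near: t; exact: nbhs_left_lt.
have te : - (e' / l) <= t by near: t; apply: nbhs_left_ge; rewrite oppr_lt0 divr_gt0.
have -> : (1 + t) * l = l + (-1) ^+ true * (- t * l) by rewrite expr1; ring.
rewrite H'; last first.
  by rewrite -(ler_pdivlMr _ _ l0) lerNl te mulr_ge0// ltW// oppr_gt0.
by rewrite expr1; field; rewrite lt_eqF.
Unshelve. all: by end_near.
Qed.

End Germs.

(** * Piecewise affine functions along finite partitions *)

Section Partitions.
Variables (R : realType) (p : nat).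
Implicit Types (f : R -> R) (a b t x : R) (s : seq R).

Definition affine_between f a b : Prop :=
  exists m c : R, Hp p m /\ forall t, a <= t <= b -> f t = m * t + c.

(** Recursive counterpart of the indexed condition in [pw_affine_Hp], suited to induction along the
    list of breakpoints. *)
Fixpoint affine_pieces f a s : Prop :=
  if s is t :: s' then affine_between f a t /\ affine_pieces f t s' else True.

Lemma affine_piecesP f a s : affine_pieces f a s <->
  forall i : nat, (i < size s)%N -> affine_between f (nth a (a :: s) i) (nth a s i).
Proof.
elim: s a => [|t s ih] a //=; rewrite ih.
have E i : (i < size s)%N -> nth a (t :: s) i = nth t (t :: s) i /\ nth a s i = nth t s i.
  by move=> hi; split; apply: set_nth_default => //; exact: leqW.
split=> [[h1 h2] [|i]//= hi|h]; first by have [-> ->] := E i hi; exact: h2.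
by split=> [|i hi]; [exact: (h 0)|have := h i.+1 hi; have [/= -> ->] := E i hi].
Qed.

Lemma affine_between_germs f a b : a < b -> affine_between f a b ->
  exists2 m : R, Hp p m & germ_slope f a false m /\ germ_slope f b true m /\
    f b - f a = m * (b - a) /\
    (forall t, a < t < b -> germ_slope f t false m /\ germ_slope f t true m).
Proof.
move=> ab [m [c [hm H]]]; exists m => //; split; [|split; [|split]].
- exists (b - a); first by rewrite subr_gt0.
  by move=> h /andP[h0 he]; rewrite !H ?expr0; [ring|lra|lra].
- exists (b - a); first by rewrite subr_gt0.
  by move=> h /andP[h0 he]; rewrite !H ?expr1; [ring|lra|lra].
- by rewrite !H; [ring|lra|lra].
move=> t /andP[at_ tb]; split.
  exists (b - t); first by rewrite subr_gt0.
  by move=> h /andP[h0 he]; rewrite !H ?expr0; [ring|lra|lra].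
exists (t - a); first by rewrite subr_gt0.
by move=> h /andP[h0 he]; rewrite !H ?expr1; [ring|lra|lra].
Qed.

Lemma germ_affine_right f a m : Hp p m -> germ_slope f a false m ->
  exists2 e : R, 0 < e & forall t, t <= a + e -> affine_between f a t.
Proof.
move=> hm [e e0 H]; exists e => // t te; exists m, (f a - m * a); split => // u uat.
have -> : u = a + (-1) ^+ false * (u - a) by rewrite expr0; ring.
by rewrite H ?expr0; [ring|lra].
Qed.

Lemma germ_affine_left f a m : Hp p m -> germ_slope f a true m ->
  exists2 e : R, 0 < e & forall t, a - e <= t -> affine_between f t a.
Proof.
move=> hm [e e0 H]; exists e => // t te; exists m, (f a - m * a); split => // u uat.
have -> : u = a + (-1) ^+ true * (a - u) by rewrite expr1; ring.
by rewrite H ?expr1; [ring|lra].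
Qed.

(* Only local data are needed: the infimum of the points from which [b] can be
   reached by finitely many pieces is attained, and can only be [a]. *)
Lemma germs_pw_affine f :
  (forall x (b : bool), 0 < x -> exists2 m : R, Hp p m & germ_slope f x b m) ->
  pw_affine_Hp p f.
Proof.
move=> H a b a0 ab.
suff [s [h1 [h2 /affine_piecesP h3]]] : exists s, path <%R a s /\ last a s = b /\ affine_pieces f a s.
  by exists s.
pose S : set R := [set t | a <= t < b /\
  exists s, path <%R t s /\ last t s = b /\ affine_pieces f t s]%classic.
(* The left germ at [x] supplies one more piece ending at [x]; the maximum with [a] keeps its left
   end inside the interval. *)
have S_left x : a < x <= b -> S x \/ x = b -> exists2 t, S t & t < x.
  move=> /andP[ax xb] hx.
  have [m hm /germ_affine_left[//|e e0 He]] := H x true (lt_trans a0 ax).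
  have tx : Num.max a (x - e) < x by rewrite gt_max ax; lra.
  exists (Num.max a (x - e)) => //; split.
    by rewrite le_max lexx/= (lt_le_trans tx).
  have piece : affine_between f (Num.max a (x - e)) x by apply: He; rewrite le_max lexx orbT.
  case: hx => [[_ [s [h1 [h2 h3]]]]|eb]; first by exists (x :: s); rewrite /= tx.
  by exists [:: x]; rewrite /= tx.
have [|t0 St0 _] := S_left b _ (or_intror erefl); first by rewrite ab lexx.
have lbS : has_lbound S by exists a => t [/andP[]].
have infS : has_inf S by split; [exists t0|].
(* The right germ at the infimum is affine up to some point of [S], so a single extra piece joins
   the two. *)
have Sinf : S (inf S).
  have ainf : a <= inf S by apply: lb_le_inf; [exists t0|move=> t [/andP[]]].
  have [m hm /germ_affine_right[//|e e0 He]] := H (inf S) false (lt_le_trans a0 ainf).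
  have [t St te] := inf_adherent e0 infS.
  have : inf S <= t by apply: ge_inf.
  rewrite le_eqVlt => /predU1P[->//|it].
  case: St => /andP[at_ tb] [s [h1 [h2 h3]]]; split.
    by rewrite ainf (lt_trans it).
  by exists (t :: s); rewrite /= it; split=> //; split=> //; split=> //; apply: He; exact: ltW.
have /andP[] := Sinf.1; rewrite le_eqVlt => /predU1P[->//|ai ib]; first by case: Sinf.
have [|t St] := S_left (inf S) _ (or_introl Sinf); first by rewrite ai ltW.
by rewrite ltNge ge_inf.
Qed.

Lemma affine_pieces_germs f a s : s != [::] -> path <%R a s -> affine_pieces f a s ->
  (exists2 m : R, Hp p m & germ_slope f a false m) /\
  (exists2 m : R, Hp p m & germ_slope f (last a s) true m).
Proof.
elim: s a => [//|t s ih] a _ /= /andP[at_ ps] [h1 h2].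
have [m hm [m1 [m2 _]]] := affine_between_germs at_ h1.
split; first by exists m.
by case: s {h1} ih ps h2 => [|u s] ih ps h2; [exists m|have [] := ih t isT ps h2].
Qed.

(** Corners occur only at breakpoints; this confines the support of a principal divisor. *)
Lemma affine_pieces_interior f a s x : path <%R a s -> affine_pieces f a s ->
  a < x < last a s -> x \notin s ->
  exists m : R, germ_slope f x false m /\ germ_slope f x true m.
Proof.
elim: s a => [|t s ih] a /=; first by move=> _ _ /andP[h1 h2]; have := lt_trans h1 h2; rewrite ltxx.
move=> /andP[at_ ps] [h1 h2] /andP[ax xl]; rewrite inE negb_or => /andP[xt xs].
have [xt'|tx|e] := ltgtP x t; last by rewrite e eqxx in xt.
  have [m _ [_ [_ [_ h]]]] := affine_between_germs at_ h1.
  by exists m; apply: h; rewrite ax.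
by apply: (ih t) => //; rewrite tx.
Qed.

(** The list [belast a s] holds the left ends of the pieces and [s] the right ends; the two inner
    slopes of a piece coincide. The second part allows any [F] so that it applies to [chi_Hp]. *)
Lemma affine_pieces_telescope f (L Rt : R -> R) a s :
  path <%R a s -> affine_pieces f a s ->
  (forall x m, germ_slope f x false m -> Rt x = m) ->
  (forall x m, germ_slope f x true m -> L x = m) ->
  \sum_(x <- s) x * L x - \sum_(x <- belast a s) x * Rt x = f (last a s) - f a /\
  (forall (V : nmodType) (F : R -> V), \sum_(x <- belast a s) F (Rt x) = \sum_(x <- s) F (L x)).
Proof.
move=> ps pc hR hL; elim: s a ps pc => [|t s ih] a /=.
  by move=> _ _; split=> [|V F]; rewrite !big_nil ?subrr.
move=> /andP[at_ ps] [h1 h2]; have [ih1 ih2] := ih t ps h2.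
have [m _ [/hR m1 [/hL m2 [m3 _]]]] := affine_between_germs at_ h1.
split=> [|V F]; rewrite !big_cons m1 m2 ?ih2//.
rewrite opprD addrACA ih1; have -> : f t = f a + m * (t - a) by rewrite -m3; ring.
by ring.
Qed.

End Partitions.

(** * Divisors, their degree and character, and surjectivity *)

Section Divisors.
Variables (R : realType) (p : nat).
Hypothesis hp : prime p.
Local Notation P := (p%:R : R).
Local Notation N := (p.-1%:Z).
Implicit Types (D : set R -> R) (s : seq (set R)) (r : seq R) (f : R -> R).

Lemma fsbig_Cp (V : nmodType) (G : set R -> V) s : uniq s ->
  (forall H, H \in s -> in_Cp p H) -> (forall H, in_Cp p H -> H \notin s -> G H = 0) ->
  \sum_(H \in Cp p) G H = \sum_(H <- s) G H.
Proof.
move=> us sC sG; rewrite [RHS]fsbig_seq//; apply/esym; apply: fsbig_widen; first by move=> H /= /sC.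
by move=> H [/= hC /negP]; exact: sG.
Qed.

Lemma chi_H0 H : in_Cp p H -> chi_H p H (0 : R) = 0.
Proof.
by case=> l [l0 ->]; rewrite (chi_HE hp)// mulr0; [exact: chi_Hp0|exact: (@Hp0 R p)].
Qed.

Lemma degE D s : uniq s -> (forall H, H \in s -> in_Cp p H) ->
  (forall H, in_Cp p H -> H \notin s -> D H = 0) -> deg p D = \sum_(H <- s) D H.
Proof. exact: fsbig_Cp. Qed.

Lemma chi_divE D s : uniq s -> (forall H, H \in s -> in_Cp p H) ->
  (forall H, in_Cp p H -> H \notin s -> D H = 0) ->
  chi_div p D = ((\sum_(H <- s) chi_H p H (D H)) %% N)%Z.
Proof.
by move=> us sC sD; rewrite /chi_div (fsbig_Cp us)// => H hC /sD ->//; exact: chi_H0.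
Qed.

Lemma divisor_support D : is_divisor p D ->
  exists s, [/\ uniq s, forall H, H \in s -> in_Cp p H & forall H, H \notin s -> D H = 0].
Proof.
case=> hC [_ /finite_seqP[s es]]; have mem H : (H \in s) = (D H != 0).
  by apply/idP/idP => h; [suff : [set` s]%classic H by rewrite -es|
    suff : [set H | D H != 0]%classic H by rewrite es].
exists (undup s); split=> [|H|H]; rewrite ?undup_uniq ?mem_undup ?mem//; first exact: hC.
by move=> /negPn/eqP.
Qed.

Lemma add_divisor D1 D2 : is_divisor p D1 -> is_divisor p D2 ->
  is_divisor p (add_div D1 D2) /\
  deg p (add_div D1 D2) = deg p D1 + deg p D2 /\
  chi_div p (add_div D1 D2) = ((chi_div p D1 + chi_div p D2) %% N)%Z.
Proof.
move=> hD1 hD2.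
have [s1 [us1 C1 h1]] := divisor_support hD1; have [s2 [us2 C2 h2]] := divisor_support hD2.
pose s := undup (s1 ++ s2).
have us : uniq s by exact: undup_uniq.
have Cs H : H \in s -> in_Cp p H by rewrite mem_undup mem_cat => /orP[/C1|/C2].
have s0 H : H \notin s -> D1 H = 0 /\ D2 H = 0.
  by rewrite mem_undup mem_cat negb_or => /andP[/h1 -> /h2 ->].
have s01 H : in_Cp p H -> H \notin s -> D1 H = 0 by move=> _ /s0[].
have s02 H : in_Cp p H -> H \notin s -> D2 H = 0 by move=> _ /s0[].
have s03 H : in_Cp p H -> H \notin s -> add_div D1 D2 H = 0.
  by rewrite /add_div => _ /s0[-> ->]; rewrite addr0.
have add_neq0 H : add_div D1 D2 H != 0 -> H \in s.
  by apply: contraNT => /s0[]; rewrite /add_div => -> ->; rewrite addr0.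
split; [split; [|split]|split].
- by move=> H /add_neq0/Cs.
- move=> H hC; have := hD1.2.1 H hC; have := hD2.2.1 H hC.
  case: hC => l [l0 ->]; rewrite !scaledP ?gt_eqF// => i1 i2.
  by rewrite /add_div mulrDr; exact: HpD.
- by apply: (@sub_finite_set _ _ [set` s]%classic) => [H /= /add_neq0|]//; exact: finite_seq.
- by rewrite !(degE us)// -big_split.
rewrite !(chi_divE us)// modzDm -big_split/=; apply: modz_sum => H /Cs hC.
have := hD1.2.1 H hC; have := hD2.2.1 H hC.
case: hC => l [l0 ->]; rewrite !scaledP ?gt_eqF// => i1 i2.
by rewrite /add_div !(chi_HE hp)// mulrDr ?chi_HpD//; exact: HpD.
Qed.

Lemma scaled_uniq r : {in r, forall x, 1 <= x < P} -> uniq r -> uniq (map (scaled p) r).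
Proof.
by move=> hr ur; rewrite map_inj_in_uniq// => x y /hr hx /hr hy; exact: scaled_fundamental.
Qed.

(** Each point of [Cp] has exactly one generator in [[1, P)], so sums over subgroups become sums
    over real numbers. *)
Lemma fundamental_sums D r : {in r, forall x, 1 <= x < P} -> uniq r ->
  (forall x, 1 <= x < P -> x \notin r -> D (scaled p x) = 0) ->
  deg p D = \sum_(x <- r) D (scaled p x) /\
  chi_div p D = ((\sum_(x <- r) chi_H p (scaled p x) (D (scaled p x))) %% N)%Z.
Proof.
move=> hr ur h0; have us := scaled_uniq hr ur.
have Cs H : H \in map (scaled p) r -> in_Cp p H.
  by move=> /mapP[x /hr/andP[x1 _] ->]; apply: scaled_in_Cp; exact: lt_le_trans x1.
have D0 H : in_Cp p H -> H \notin map (scaled p) r -> D H = 0.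
  move=> /(in_CpP hp)[x hx ->] xr; apply: h0 => //.
  by apply: contra xr => xr; exact: map_f.
by rewrite (degE us)// (chi_divE us)// !big_map.
Qed.

Definition point_div (l d : R) : set R -> R :=
  fun H => if H == scaled p l then l * d else 0.

Lemma point_divisor (l d : R) : 0 < l -> Hp p d ->
  [/\ is_divisor p (point_div l d), deg p (point_div l d) = l * d &
      chi_div p (point_div l d) = chi_Hp p d].
Proof.
move=> l0 hd; have lC := scaled_in_Cp p l0.
have C1 H : H \in [:: scaled p l] -> in_Cp p H by rewrite inE => /eqP ->.
have D1 H : in_Cp p H -> H \notin [:: scaled p l] -> point_div l d H = 0.
  by rewrite inE /point_div => _ /negPf ->.
have hl : scaled p l (l * d) by exists d.
split.
- split; [|split].
  + by move=> H; rewrite /point_div; have [->|_] := eqVneq H (scaled p l); rewrite ?eqxx.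
  + move=> H; rewrite /point_div; case: eqP => [->//|_ [l' [l'0 ->]]].
    by exists 0; [exact: (@Hp0 R p)|rewrite mulr0].
  apply: (@sub_finite_set _ _ [set scaled p l]%classic); last exact: finite_set1.
  by move=> H /=; rewrite /point_div; have [->|_] := eqVneq H (scaled p l); rewrite ?eqxx.
- by rewrite (@degE _ [:: scaled p l])// big_seq1 /point_div eqxx.
rewrite (@chi_divE _ [:: scaled p l])// big_seq1 /point_div eqxx.
by rewrite (chi_HE hp) ?mulKf ?gt_eqF// chi_Hp_mod.
Qed.

Lemma divisor_surj (x : R) (c : int) :
  exists D, is_divisor p D /\ deg p D = x /\ chi_div p D = (c %% N)%Z.
Proof.
have N0 : (0 < N)%R by rewrite ltz_nat -subn1 subn_gt0 prime_gt1.
(* [d1] has the residue of [c], and adding [N] makes it positive even when that residue is 0; [d2]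
   is negative with residue 0. *)
pose d1 := (c %% N)%Z + N; pose d2 := - N.
have d10 : 0 < d1 by rewrite ltr_wpDl// modz_ge0// gt_eqF.
have e10 : 0 < d1%:~R :> R by rewrite ltr0z.
have e20 : d2%:~R < 0 :> R by rewrite ltrz0 oppr_lt0.
(* The degrees [|x| + 1 > 0] and [x - |x| - 1 < 0] add up to [x]; their signs match those of [d1]
   and [d2], so both scaling factors are positive. *)
have l10 : 0 < (`|x| + 1) / d1%:~R by rewrite divr_gt0// ltr_wpDl.
have l20 : 0 < (x - `|x| - 1) / d2%:~R.
  rewrite -mulrNN -invrN divr_gt0 ?oppr_gt0//.
  by have := ler_norm x; lra.
have [D1 deg1 chi1] := point_divisor l10 (Hp_int R p d1).
have [D2 deg2 chi2] := point_divisor l20 (Hp_int R p d2).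
have [hD [hdeg hchi]] := add_divisor D1 D2.
eexists; split; [exact: hD|split].
  by rewrite hdeg deg1 deg2 !divfK ?(gt_eqF e10) ?(lt_eqF e20)//; ring.
rewrite hchi chi1 chi2 !chi_Hp_int// modzDm /d1 /d2.
by rewrite addrK modz_mod.
Qed.

End Divisors.

(** * Principal divisors have degree and character zero *)

Section Principal.
Variables (R : realType) (p : nat).
Hypothesis hp : prime p.
Local Notation P := (p%:R : R).
Local Notation N := (p.-1%:Z).
Implicit Types (f : R -> R) (b : bool).

Lemma periodic_expz f : (forall x, 0 < x -> f (P * x) = f x) ->
  forall (k : int) x, 0 < x -> f (P ^ k * x) = f x.
Proof.
move=> fp; have pos (n : nat) x : 0 < x -> f (P ^+ n * x) = f x.
  elim: n x => [|n ih] x x0; first by rewrite mul1r.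
  by rewrite exprS -mulrA fp ?ih// mulr_gt0// exprn_gt0// (prime_gt0r R hp).
case=> n x x0; first exact: pos.
have xn : 0 < P ^ Negz n * x by rewrite mulr_gt0// (expz_gt0r R hp).
rewrite -(pos n.+1 _ xn) mulrA exprnP -expfzDr ?(prime_neq0r R hp)//.
by rewrite NegzE subrr expr0z mul1r.
Qed.

Lemma principal_out f H : ~ in_Cp p H -> principal p f H = 0.
Proof. by rewrite /principal; case: pselect. Qed.

(** [Ord] is evaluated at an unspecified generator [P ^ k * l], where the slopes are divided by
    [P ^ k]; the two factors cancel. *)
Lemma principal_scaled f (l m m' : R) : (forall x, 0 < x -> f (P * x) = f x) -> 0 < l ->
  germ_slope f l false m -> germ_slope f l true m' ->
  principal p f (scaled p l) = l * (m - m').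
Proof.
move=> fp l0 h h'; rewrite /principal; case: pselect => /= [_|]; last by case; exact: scaled_in_Cp.
rewrite /Ord; have [] := @xgetI _ 1 [set x | 0 < x /\ scaled p l = scaled p x]%classic l (conj l0 erefl).
set l' := xget _ _ => l'0 e.
have [k ->] := scaled_eq hp l0 l'0 e; have c0 := expz_gt0r R hp k.
have fk t : 0 < t -> f (P ^ k * t) = f t by exact: periodic_expz.
rewrite (@ord_at_germ _ _ _ (m / P ^ k) (m' / P ^ k)) ?mulr_gt0//.
- by field; rewrite gt_eqF.
- exact: germ_slope_scale.
- exact: germ_slope_scale.
Qed.

(** The germ comes from the end piece of a partition of [[x / 2, x]] or of [[x, x + 1]], both inside
    the positive axis. *)
Lemma in_K_germ f x b : in_K p f -> 0 < x -> exists2 m : R, Hp p m & germ_slope f x b m.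
Proof.
case=> _ [pw _] x0; case: b.
  have xx : x / 2 < x by lra.
  have [|s [ps [ls /affine_piecesP hs]]] := pw (x / 2) x _ xx; first by lra.
  have s0 : s != [::] by apply/eqP => s0; move: ls xx; rewrite s0 /=; lra.
  by have [_] := affine_pieces_germs s0 ps hs; rewrite ls.
have xx : x < x + 1 by rewrite ltrDl.
have [s [ps [ls /affine_piecesP hs]]] := pw x (x + 1) x0 xx.
have s0 : s != [::] by apply/eqP => s0; move: ls xx; rewrite s0 /=; lra.
by have [] := affine_pieces_germs s0 ps hs.
Qed.

Definition side_slope f b (x : R) : R := xget 0 (germ_slope f x b).

Lemma side_slopeE f x b m : germ_slope f x b m -> side_slope f b x = m.
Proof. by move=> h; apply: xget_unique => // m' /germ_slope_unique; exact. Qed.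

Lemma in_K_side_slope f x b : in_K p f -> 0 < x ->
  Hp p (side_slope f b x) /\ germ_slope f x b (side_slope f b x).
Proof. by move=> hf x0; have [m hm h] := in_K_germ b hf x0; rewrite (side_slopeE h). Qed.

Lemma belast_bounds (a : R) (s : seq R) : path <%R a s ->
  uniq (belast a s) /\ {in belast a s, forall x, a <= x < last a s}.
Proof.
elim: s a => [|t s ih] a //= /andP[at_ ps]; have [u h] := ih t ps; split.
  by rewrite u andbT; apply/negP => /h; lra.
have tl : t <= last t s by case: s {ih u} ps h => //= v s _ /(_ t); rewrite mem_head => /(_ isT); lra.
by move=> x; rewrite inE => /predU1P[->|/h]; lra.
Qed.

(** Left and right ends of the pieces differ only by [a] against [last a s]; this is how the seam is
    closed. *)
Lemma big_belast (V : zmodType) (F : R -> V) a s : F a = F (last a s) ->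
  \sum_(x <- belast a s) F x = \sum_(x <- s) F x.
Proof.
move=> h; have := congr1 (fun r => \sum_(x <- r) F x) (lastI a s).
by rewrite big_cons -cats1 big_cat big_seq1/= -h => e; apply: (addrI (F a)); rewrite e addrC.
Qed.

Lemma principal_degree0 f : in_K p f ->
  is_divisor p (principal p f) /\ deg p (principal p f) = 0 /\ chi_div p (principal p f) = 0.
Proof.
move=> hf; have fp := hf.2.2; have P1 := prime_gt1r R hp; have P0 := prime_gt0r R hp.
pose L := side_slope f true; pose Rt := side_slope f false.
have LE x : 0 < x -> Hp p (L x) /\ germ_slope f x true (L x) by exact: in_K_side_slope.
have RE x : 0 < x -> Hp p (Rt x) /\ germ_slope f x false (Rt x) by exact: in_K_side_slope.
have prE x : 0 < x -> principal p f (scaled p x) = x * (Rt x - L x).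
  by move=> x0; apply: principal_scaled => //; [case: (RE x x0)|case: (LE x x0)].
have [s [ps [ls /affine_piecesP hs]]] := hf.2.1 1 P ltr01 P1.
(* The last breakpoint [P] is dropped, since it represents the same point of [Cp] as 1. *)
pose r := belast 1 s; have [ur] := belast_bounds ps; rewrite ls -/r => hr.
have r0 x : x \in r -> 0 < x by move=> /hr; lra.
have out x : 1 <= x < P -> x \notin r -> principal p f (scaled p x) = 0.
  move=> /andP[x1 xP] xr; have xs : x \notin (1 :: s).
    by rewrite lastI mem_rcons inE negb_or xr andbT ls lt_eqF.
  move: xs; rewrite inE negb_or => /andP[x1' xs].
  have [|m [h1 h2]] := affine_pieces_interior ps hs _ xs.
    by rewrite ls xP lt_neqAle eq_sym x1' x1.
  by rewrite (principal_scaled fp _ h1 h2) ?subrr ?mulr0//; lra.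
have [hdeg hchi] := fundamental_sums hp hr ur out.
have [tel chiE] := affine_pieces_telescope ps hs
  (fun x m (h : germ_slope f x false m) => side_slopeE h)
  (fun x m (h : germ_slope f x true m) => side_slopeE h).
have LP : L 1 = P * L P.
  have := germ_slope_scale P0 ltr01 fp (LE 1 ltr01).2; rewrite mulr1 => /side_slopeE.
  by rewrite -/(L P) => ->; rewrite mulrC divfK ?gt_eqF.
split; [split; [|split]|split].
- by move=> H; apply: contra_neqP => /principal_out ->.
- move=> H [l [l0 ->]]; rewrite prE// scaledP ?gt_eqF// mulKf ?gt_eqF//.
  by apply: HpD => //; [case: (RE l l0)|apply: HpN; case: (LE l l0)].
- apply: (@sub_finite_set _ _ [set` map (scaled p) r]%classic); last exact: finite_seq.
  move=> H /=; apply: contraNT => Hr; apply/eqP.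
  have [/(in_CpP hp)[x hx e]|/principal_out//] := pselect (in_Cp p H).
  rewrite e; apply: out => //.
  by apply: contra Hr => xr; rewrite e; exact: map_f.
(* The seam relation [1 * L 1 = P * L P] lets the left slopes be summed over right ends instead; the
   telescoping sum is then [f P - f 1], up to sign. *)
- rewrite hdeg big_seq; under eq_bigr => x xr do rewrite (prE _ (r0 x xr)) mulrBr.
  rewrite -big_seq sumrB (big_belast (F := fun x => x * L x)); last by rewrite ls mul1r.
  apply: (@oppr_inj R); rewrite opprB oppr0 tel ls -(fp 1 ltr01) mulr1 subrr.
  by [].
(* Here the seam needs [chi (P * L P) = chi (L P)]. *)
have chi_sum0 : \sum_(x <- r) (chi_Hp p (Rt x) - chi_Hp p (L x)) = 0.
  rewrite sumrB (chiE _ (chi_Hp p)) (big_belast (F := fun x => chi_Hp p (L x))) ?subrr//.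
  by rewrite ls LP -(expr1z P) chi_Hp_expz//; case: (LE P P0).
rewrite hchi -[RHS](mod0z N) -[in RHS]chi_sum0.
apply: modz_sum => x /r0 x0; have [hR _] := RE x x0; have [hL _] := LE x x0.
rewrite prE// (chi_HE hp)// mulKf ?gt_eqF// ?chi_HpB//.
by apply: HpD => //; apply: HpN.
Qed.

(** * Periodic extension and the realization of divisors in the kernel *)

Lemma periodic_germs f : (forall x, 0 < x -> f (P * x) = f x) ->
  (forall x, 1 <= x < P -> exists2 m : R, Hp p m & germ_slope f x false m) ->
  (forall x, 1 < x <= P -> exists2 m : R, Hp p m & germ_slope f x true m) ->
  forall x b, 0 < x -> exists2 m : R, Hp p m & germ_slope f x b m.
Proof.
move=> fp hR hL x b x0; have P0 := prime_neq0r R hp.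
have mv (k : int) : (exists2 m, Hp p m & germ_slope f (P ^ k * x) b m) ->
    exists2 m, Hp p m & germ_slope f x b m.
  case=> m hm h; exists (m * P ^ k); first by apply: HpM => //; exact: Hp_expz.
  have -> : x = P ^ (- k) * (P ^ k * x) by rewrite mulrA -expfzDr// addNr expr0z mul1r.
  have -> : m * P ^ k = m / P ^ (- k) by rewrite -invr_expz invrK.
  apply: germ_slope_scale => //.
  - exact: expz_gt0r.
  - by rewrite mulr_gt0// expz_gt0r.
  - exact: periodic_expz.
have [k hk] := expz_floor_log hp x0.
case: b mv => mv; last by apply: (mv k); exact: hR.
have [h1|h1] := ltP 1 (P ^ k * x).
  by apply: (mv k); apply: hL; lra.
(* A left germ at 1 leaves the fundamental interval, so the point is moved to [P] instead. *)
apply: (mv (k + 1)); rewrite expfzDr// expr1z mulrAC.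
have -> : P ^ k * x = 1 by lra.
by rewrite mul1r; apply: hL; have := prime_gt1r R hp; lra.
Qed.

(** For [t > 0] the exponent exists and is unique; the default 0 is taken only for [t <= 0]. *)
Definition fundamental_exp (t : R) : int := xget 0 [set k : int | 1 <= P ^ k * t < P]%classic.

Definition periodize (g : R -> R) (t : R) : R := g (P ^ fundamental_exp t * t).

(** The closed end [P] is allowed because [g P = g 1]: there the chosen exponent is [j - 1]. *)
Lemma periodizeE g (j : int) t : g P = g 1 -> 0 < t -> 1 <= P ^ j * t <= P ->
  periodize g t = g (P ^ j * t).
Proof.
move=> gP t0 hj; have P0 := prime_neq0r R hp.
have hk : 1 <= P ^ fundamental_exp t * t < P.
  have [k hk] := expz_floor_log hp t0.
  exact: (@xgetI _ 0 [set i : int | 1 <= P ^ i * t < P]%classic k).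
rewrite /periodize; have shift i : P ^ (i - fundamental_exp t) * (P ^ fundamental_exp t * t) = P ^ i * t.
  by rewrite mulrA -expfzDr// subrK.
have uniq_exp i : 1 <= P ^ i * t < P -> fundamental_exp t = i.
  move=> hi; have := expz_fundamental hp hk; rewrite -(shift i) in hi.
  by move=> /(_ _ hi)/eqP; rewrite subr_eq0 => /eqP.
case/andP: hj => j1; rewrite le_eqVlt => /predU1P[e|jP]; last first.
  by rewrite (uniq_exp j)// j1.
have e1 : P ^ (j - 1) * t = 1.
  by rewrite expfzDr// mulrAC e exprN1 divff.
by rewrite (uniq_exp (j - 1)) ?e1 ?e ?gP// lexx prime_gt1r.
Qed.

Lemma periodize_periodic g : g P = g 1 ->
  forall x, 0 < x -> periodize g (P * x) = periodize g x.
Proof.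
move=> gP x x0; have [k /andP[k1 k2]] := expz_floor_log hp x0.
have e : P ^ (k - 1) * (P * x) = P ^ k * x.
  by rewrite mulrA -{2}(expr1z P) -expfzDr ?(prime_neq0r R hp)// subrK.
have hk : 1 <= P ^ k * x <= P by rewrite k1 ltW.
rewrite (periodizeE gP x0 hk) -e (periodizeE (j := k - 1) gP) ?e//.
by rewrite mulr_gt0// prime_gt0r.
Qed.

Lemma periodize_germ_right g x m : g P = g 1 -> 1 <= x < P ->
  germ_slope g x false m -> germ_slope (periodize g) x false m.
Proof.
move=> gP /andP[x1 xP]; apply: germ_slope_eq; exists (P - x); first by rewrite subr_gt0.
move=> h /andP[h0 he]; rewrite expr0 mul1r.
by rewrite (periodizeE (j := 0) gP) ?expr0z ?mul1r//; lra.
Qed.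

Lemma periodize_germ_left g x m : g P = g 1 -> 1 < x <= P ->
  germ_slope g x true m -> germ_slope (periodize g) x true m.
Proof.
move=> gP /andP[x1 xP]; apply: germ_slope_eq; exists (x - 1); first by rewrite subr_gt0.
move=> h /andP[h0 he]; rewrite expr1 mulN1r.
by rewrite (periodizeE (j := 0) gP) ?expr0z ?mul1r//; lra.
Qed.

Lemma divisor_fundamental_support (D : set R -> R) : is_divisor p D ->
  exists r : seq R, [/\ uniq r, {in r, forall x, 1 <= x < P} &
    forall x, 1 <= x < P -> x \notin r -> D (scaled p x) = 0].
Proof.
move=> /divisor_support[s [us sC s0]].
pose rep H : R := xget 1 [set x | 1 <= x < P /\ H = scaled p x]%classic.
have repP H : in_Cp p H -> 1 <= rep H < P /\ H = scaled p (rep H).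
  by move=> /(in_CpP hp)[x hx e]; exact: (@xgetI _ 1 [set z | 1 <= z < P /\ H = scaled p z]%classic x).
exists (undup (map rep s)); split; first exact: undup_uniq.
  by move=> x; rewrite mem_undup => /mapP[H /sC/repP[h _] ->].
move=> x hx; rewrite mem_undup => xr; apply: s0; apply: contra xr => xs.
have [h1 h2] := repP _ (sC _ xs).
by rewrite (scaled_fundamental hp hx h1 h2); exact: map_f.
Qed.

(* On [1, p] take [f x = m0 x + sum_z d_z max(0, x - z)].  The jumps are then the
   [d_z] at interior points.  With [sum d_z = (p - 1) y] (this is [chi D = 0]), the
   choice [m0 = - p y] makes the jump at the class of [1] correct, and
   [deg D = 0] is then [f p = f 1]. *)
Lemma kernel_principal (D : set R -> R) : is_divisor p D -> deg p D = 0 ->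
  chi_div p D = 0 -> exists f, in_K p f /\ D = principal p f.
Proof.
move=> hD deg0 chi0; have P1 := prime_gt1r R hp; have P0 := prime_gt0r R hp.
have [r [ur hr r0]] := divisor_fundamental_support hD.
have [] := fundamental_sums hp hr ur r0; rewrite deg0 chi0 => sum0 sumchi.
pose d z := z^-1 * D (scaled p z).
have dE z : 0 < z -> D (scaled p z) = z * d z by move=> z0; rewrite mulVKf ?gt_eqF.
have hd z : 0 < z -> Hp p (d z).
  by move=> z0; rewrite -scaledP ?gt_eqF//; apply: hD.2.1; exact: scaled_in_Cp.
have rpos z : z \in r -> 0 < z by move=> /hr; lra.
have hdr z : z \in r -> Hp p (d z) by move=> /rpos; exact: hd.
(* The vanishing of [chi] puts the sum of the jumps in the kernel of [chi_Hp], that is in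
   [(P - 1) Hp]. *)
have [y hy ey] : exists2 y : R, Hp p y & \sum_(z <- r) d z = (P - 1) * y.
  apply: (chi_Hp_eq0 hp); first exact: Hp_sum.
  rewrite -chi_Hp_mod//; last exact: Hp_sum.
  rewrite chi_Hp_sum// [RHS]sumchi; apply: modz_sum => z zr.
  by rewrite (chi_HE hp) ?rpos//; exact: hdr.
have szd : \sum_(z <- r) z * d z = 0.
  rewrite [RHS]sum0 big_seq [RHS]big_seq; apply: eq_bigr => z zr.
  by rewrite dE ?rpos.
pose g t := - (P * y) * t + \sum_(z <- r) d z * Num.max 0 (t - z).
(* All ramps vanish at 1 and are affine at [P], so both values are [- P y]: indeed
   [- P^2 y + P (P - 1) y - 0 = - P y]. *)
have gP : g P = g 1.
  have -> : g 1 = - (P * y).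
    rewrite /g mulr1 big_seq big1 ?addr0// => z /hr/andP[z1 _].
    by rewrite max_l ?mulr0// subr_le0.
  rewrite /g; have -> : \sum_(z <- r) d z * Num.max 0 (P - z) = P * \sum_(z <- r) d z - \sum_(z <- r) z * d z.
    rewrite mulr_sumr -sumrB big_seq [RHS]big_seq; apply: eq_bigr => z /hr/andP[_ zP].
    by rewrite max_r; [ring|rewrite subr_ge0 ltW].
  by rewrite szd ey; ring.
pose G b x : R := - (P * y) + \sum_(z <- r) d z * (if b then z < x else z <= x)%:R.
have gG x b : germ_slope g x b (G b x).
  apply: germ_slopeD; first by rewrite -[X in germ_slope _ _ _ X]mulr1; exact: germ_slopeM (germ_slope_id _ _).
  by apply: germ_slope_sum => z; apply: germ_slopeM; exact: germ_slope_ramp.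
have hG b x : Hp p (G b x).
  apply: HpD => //; first by apply: HpN; apply: HpM => //; exact: (Hp_int R p p%:Z).
  by apply: Hp_sum => // z zr; apply: HpM => //; [exact: hdr|exact: (Hp_int R p (nat_of_bool _)%:Z)].
pose f := periodize g; have fp := periodize_periodic gP : forall x, 0 < x -> f (P * x) = f x.
have fgerm := periodic_germs fp
  (fun x hx => ex_intro2 _ _ _ (hG false x) (periodize_germ_right gP hx (gG x false)))
  (fun x hx => ex_intro2 _ _ _ (hG true x) (periodize_germ_left gP hx (gG x true))).
exists f; split.
  split=> [x x0|]; last by split=> //; exact: germs_pw_affine.
  have [m _ hm] := fgerm x false x0; have [m' _ hm'] := fgerm x true x0.
  exact: germ_slope_continuous hm hm'.
apply/funext => H; have [HC|HC] := pselect (in_Cp p H); last first.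
  by rewrite principal_out//; apply/eqP/negPn/negP => /hD.1.
have [x hx ->] := in_CpP hp HC; have x0 : 0 < x by lra.
have fL : germ_slope f x true (G true x).
  have [x1|x1] := ltP 1 x; first by apply: periodize_germ_left => //; lra.
  have -> : x = 1 by lra.
  (* The left slope of [f] at 1 is [P] times the one at [P], which is [- P y + (P - 1) y = - y]; so
     it equals the initial slope [- P y], as if [g] had no corner to the left of 1. *)
  have -> : G true 1 = G true P * P.
    rewrite /G big_seq big1 => [|z /hr/andP[z1 _]]; last by rewrite ltNge z1 mulr0.
    rewrite big_seq; under eq_bigr => z zr do rewrite (andP (hr z zr)).2 mulr1.
    by rewrite -big_seq ey; ring.
  have := @germ_slope_scale _ f P^-1 P (G true P) true; rewrite mulVf ?gt_eqF// invrK.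
  apply => //; first by rewrite invr_gt0.
    by move=> t t0; rewrite -fp ?mulVKf ?gt_eqF// mulr_gt0// invr_gt0.
  by apply: periodize_germ_left => //; rewrite P1 lexx.
rewrite (principal_scaled fp x0 (periodize_germ_right gP hx (gG x false)) fL).
(* The weak and strict comparisons differ only at [z = x], which isolates the prescribed jump. *)
have -> : G false x - G true x = \sum_(z <- r) d z * (z == x)%:R.
  rewrite /G opprD addrACA subrr add0r -sumrB; apply: eq_bigr => z _.
  by rewrite -mulrBr; congr (_ * _); case: ltgtP => _; rewrite ?subrr ?subr0.
have [xr|xr] := boolP (x \in r).
  rewrite (bigD1_seq x)//= eqxx mulr1 big1 ?addr0 ?dE// => z /negPf ->.
  by rewrite mulr0.
rewrite r0// big_seq big1 ?mulr0// => z zr; case: eqP => [e|]; last by rewrite mulr0.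
by rewrite -e zr in xr.
Qed.

End Principal.

Theorem theorem5p6 (R : realType) (p : nat) (hp : prime p) :
  (* deg and chi are homomorphisms Div(C_p) -> R, Z/(p-1)Z *)
  (forall D1 D2 : set R -> R, is_divisor p D1 -> is_divisor p D2 ->
     is_divisor p (add_div D1 D2) /\
     deg p (add_div D1 D2) = deg p D1 + deg p D2 /\
     chi_div p (add_div D1 D2) = ((chi_div p D1 + chi_div p D2) %% (p.-1)%:Z)%Z) /\
  (* principal divisors are divisors, and deg, chi vanish on them *)
  (forall f : R -> R, in_K p f ->
     is_divisor p (principal p f) /\ deg p (principal p f) = 0 /\
     chi_div p (principal p f) = 0%Z) /\
  (* the induced map Div/P -> R x Z/(p-1)Z is injective *)
  (forall D : set R -> R, is_divisor p D -> deg p D = 0 -> chi_div p D = 0%Z ->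
     exists f : R -> R, in_K p f /\ D = principal p f) /\
  (* ... and surjective *)
  (forall (r : R) (c : int), exists D : set R -> R,
     is_divisor p D /\ deg p D = r /\ chi_div p D = (c %% (p.-1)%:Z)%Z).

Proof.
split; first by move=> D1 D2; exact: add_divisor.
split; first by move=> f; exact: principal_degree0.
split; first by move=> D; exact: kernel_principal.
by move=> r c; exact: divisor_surj.
Qed.
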